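(* Let $f=\sum_{|\alpha|\ge1}a_\alpha X_\alpha$ be a positive regular free holomorphic function and let $\mathcal P$ be a set of noncommutative polynomials. If $T=(T_1,\dots,T_n)\in\mathcal V^1_{f,\mathcal P}(\mathcal H)$ is such that $\Phi_{f,T}(I)\ne I$ and there is a non-zero vector $h\in\mathcal H$ such that $\langle\Phi_{f,T}^k(I)h,h\rangle=\|h\|^2$ for any $k\in\mathbb N$, then there is a non-trivial invariant subspace under the operators $T_1,\dots,T_n$.
   Context: Let $n\in\mathbb N=\{1,2,\dots\}$. $\mathbb F_n^+$ is the unital free semigroup on generators $g_1,\dots,g_n$ with identity $g_0$; $|\alpha|$ is the word length ($|g_0|=0$). For $X=(X_1,\dots,X_n)\in B(\mathcal H)^n$ ($\mathcal H$ a complex Hilbert space) put $X_\alpha=X_{i_1}\cdots X_{i_k}$ if $\alpha=g_{i_1}\cdots g_{i_k}$ and $X_{g_0}=I$. A positive regular free holomorphic function is a formal series $f=\sum_{\alpha\in\mathbb F_n^+}a_\alpha X_\alpha$ in noncommuting variables with $\limsup_{k\to\infty}(\sum_{|\alpha|=k}|a_\alpha|^2)^{1/2k}<\infty$, $a_\alpha\ge 0$ for all $\alpha$, $a_{g_0}=0$, and $a_{g_i}>0$ for $i=1,\dots,n$. Whenever $\sum_{|\alpha|\ge1}a_\alpha X_\alpha X_\alpha^*$ converges in the weak operator topology (WOT), $\Phi_{f,X}(Y)=\sum_{|\alpha|\ge1}a_\alpha X_\alpha YX_\alpha^*$ for $Y\in B(\mathcal H)$ (WOT convergence). $\mathcal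 V^1_{f,\mathcal P}(\mathcal H)$ is the set of all $X\in B(\mathcal H)^n$ with $\sum_{|\alpha|\ge1}a_\alpha X_\alpha X_\alpha^*\le I$ and $p(X_1,\dots,X_n)=0$ for all $p\in\mathcal P$. A non-trivial invariant subspace under $T_1,\dots,T_n$ is a closed subspace different from $\{0\}$ and $\mathcal H$ that is invariant under each $T_i$. *)

(* Defs.v *)
From HB Require Import structures.
From mathcomp Require Import all_boot all_order all_algebra.
From mathcomp Require Import complex.
From mathcomp Require Import all_classical all_reals all_analysis.
(* the notations of monalg do not load together with those of analysis *)
From mathcomp Require Import -(notations) monalg.

Set Implicit Arguments.
Unset Strict Implicit.
Unset Printing Implicit Defensive.

Import Order.TTheory GRing.Theory Num.Theory.
Import numFieldNormedType.Exports.

Local Open Scope classical_set_scope.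
Local Open Scope complex_scope.
Local Open Scope ring_scope.

(* Words of the free semigroup on n generators are sequences over 'I_n, the
   identity g_0 being [::].  A formal series with real coefficients in n
   noncommuting variables is identified with its coefficient function. *)
Definition positive_regular_free_holomorphic (R : realType) (n : nat)
    (a : seq 'I_n -> R) : Prop :=
  [/\ (limn_esup (fun k => ((\sum_(w : k.-tuple 'I_n) `|a w| ^+ 2)
         `^ (2 * k)%N%:R^-1)%:E) < +oo)%E,
      forall w, 0 <= a w,
      a [::] = 0
    & forall i, 0 < a [:: i]].

Definition nc_polynomial (R : realType) (n : nat) : Type :=
  malg (fmonom 'I_n) R[i].

Section Hilbert.
Variables (R : realType) (H : completeNormedModType R[i]).
(* linear in the first argument, conjugate linear in the second one *)
Variable dot : {dot H for Num.conj}.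

Definition hilbert_norm : Prop := forall x : H, `|x| ^+ 2 = dot x x.

(* B(H), as a set of functions *)
Definition bounded_operator : set (H -> H) :=
  [set A | linear A /\ continuous A].

(* The function 0 is a default value, never taken on bounded operators of a
   Hilbert space. *)
Definition adjoint (A : H -> H) : H -> H :=
  xget (fun=> 0) [set B | bounded_operator B /\
                          forall x y, dot (A x) y = dot x (B y)].

Definition op_le (A B : H -> H) : Prop :=
  forall x, dot (A x) x <= dot (B x) x.

Variable n : nat.

Definition op_word (X : 'I_n -> H -> H) (w : seq 'I_n) : H -> H :=
  foldr (fun i A => X i \o A) idfun w.

Definition op_polynomial (p : nc_polynomial R n) (X : 'I_n -> H -> H) : H -> H :=
  fun x => \sum_(w <- finmap.enum_fset (msupp p)) mcoeff w p *: op_word X w x.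

(* [S] is the sum of [F w] over the words [w] of length at least one, in the
   weak operator topology; the terms are grouped by length. *)
Definition is_wot_sum (F : seq 'I_n -> H -> H) (S : H -> H) : Prop :=
  forall x y,
    (fun N => dot (\sum_(1 <= k < N) \sum_(w : k.-tuple 'I_n) F w x) y) @ \oo
      --> dot (S x) y.

Variable a : seq 'I_n -> R.

Definition Phi_term (X : 'I_n -> H -> H) (Y : H -> H) (w : seq 'I_n) : H -> H :=
  fun x => (a w)%:C *: op_word X w (Y (adjoint (op_word X w) x)).

Definition Phi_converges (X : 'I_n -> H -> H) (Y : H -> H) : Prop :=
  exists2 S, bounded_operator S & is_wot_sum (Phi_term X Y) S.

(* equal to 0 by convention when the series does not converge *)
Definition Phi (X : 'I_n -> H -> H) (Y : H -> H) : H -> H :=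
  xget (fun=> 0) [set S | bounded_operator S /\ is_wot_sum (Phi_term X Y) S].

(* The convergence of the series is part of the inequality: the default value
   of [Phi] would satisfy it. *)
Definition noncommutative_variety (P : set (nc_polynomial R n)) :
    set ('I_n -> H -> H) :=
  [set X | [/\ forall i, bounded_operator (X i),
               Phi_converges X idfun,
               op_le (Phi X idfun) idfun
             & forall p, P p -> op_polynomial p X = (fun=> 0)]].

Definition nontrivial_invariant_subspace (T : 'I_n -> H -> H) (M : set H) :
    Prop :=
  [/\ GRing.submod_closed (mem M),
      closed M,
      M <> [set 0],
      M <> setT
    & forall i x, M x -> M (T i x)].

End Hilbert.

(* Main.v *)
From HB Require Import structures.
Require Import Defs.
From mathcomp Require Import all_boot all_order all_algebra.
From mathcomp Require Import complex ring.
From mathcomp Require Import all_classical all_reals all_analysis.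

Import Order.TTheory GRing.Theory Num.Theory.
Import numFieldNormedType.Exports.

Local Open Scope classical_set_scope.
Local Open Scope complex_scope.
Local Open Scope ring_scope.

(** Write S_k for the k-th iterate of Phi at the identity, so that S_0 = I and
    S_{k+1} = Phi(S_k), and let M be the set of the vectors m such that
    <S_k m, m> = <m, m> for all k.  The invariant subspace is the orthogonal
    complement of M.

    A complement is always a closed subspace ([orthogonal_closed]), and here it
    is proper because the given vector h lies in M.  It is invariant under T_i
    as soon as M is invariant under the adjoint of T_i.  For the latter, expand
      <S_1 m, m> - <S_{k+1} m, m>
        = sum_w a_w (<T_w^* m, T_w^* m> - <S_k T_w^* m, T_w^* m>).
    Since S_k <= I, which follows by induction from the same expansion and from
    S_1 <= I, the terms are nonnegative, so each one is at most the left-hand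
    side ([Phi_gap_ge_term]).  For m in M the left-hand side is 0, and the term
    of the one-letter word g_i, whose coefficient is positive, says that T_i^* m
    is in M.

    That the complement is nonzero is where S_1 <> I enters.  The operator
    B = I - S_1 is positive and <B m, m> = 0 on M, so B vanishes on M
    ([positive_form_eq0]); being self-adjoint, it takes its values in the
    complement of M, and it is not the zero operator.

    The convergence of the series defining S_{k+1} comes from the hypothesis on
    h: a divergent series would make S_{k+1} the default value 0, contradicting
    <S_{k+1} h, h> = |h|^2 <> 0.

    The adjoints T_w^* exist by the Riesz representation theorem, which is
    proved by minimizing the energy |x|^2 - 2 Re phi(x)
    ([riesz_representation]). *)

Set Implicit Arguments.
Unset Strict Implicit.

(** * Limits and inequalities in the complex numbers *)

(** Stated for fields that need not be totally ordered, such as the complex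
    numbers, where nonnegativity also says that z is real: z equals its norm
    because the terms u N do. *)
Lemma cvg_ge0 (K : numFieldType) (u : nat -> K) (z : K) :
  u @ \oo --> z -> (\forall N \near \oo, 0 <= u N) -> 0 <= z.
Proof.
move=> /cvgrPdist_lt uz u0.
suff zE : `| `|z| - z | = 0 by rewrite -(subr0_eq (normr0_eq0 zE)).
apply/eqP; rewrite -[_ == _]negbK; apply/negP => zN.
have e0 : 0 < `| `|z| - z | / 2 by rewrite divr_gt0// normr_gt0 -normr_eq0.
have [N _ /(_ N (leqnn N))[/= zu uN]] :
  \forall N \near \oo, `|z - u N| < `| `|z| - z | / 2 /\ 0 <= u N.
  by near=> N; split; near: N; [exact: uz|].
suff : `| `|z| - z | < `| `|z| - z | by rewrite ltxx.
rewrite [ltRHS]splitr.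
have zs : `|z| - z = (`|z| - `|u N|) + (u N - z).
  by rewrite (ger0_norm uN); ring.
rewrite {1}zs (le_lt_trans (ler_normD _ _))// ltr_leD//; last first.
  by rewrite distrC ltW.
by rewrite (le_lt_trans (ler_dist_dist _ _)).
Unshelve. all: by end_near. Qed.

(** Optimality along complex lines: a homogeneous first-order term f whose real
    part is compensated by a second-order term q must vanish. *)
Lemma homogeneous_perturbation_eq0 (C : numClosedFieldType) (V : lmodType C)
    (f q : V -> C) :
  (forall c z, f (c *: z) = c * f z) ->
  (forall c z, q (c *: z) = `|c| ^+ 2 * q z) ->
  (forall z, 0 <= q z) ->
  (forall z, 0 <= f z + (f z)^* + q z) ->
  forall z, f z = 0.
Proof.
move=> fZ qZ q0 fq z.
(* Along -s (f z)^* z with s real the hypothesis reads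
   0 <= |f z|^2 (-2 s + s^2 q z); this s makes the second factor negative
   whatever the value of q z. *)
pose s := (1 + q z)^-1.
have q1 : 0 < 1 + q z by rewrite ltr_pwDl.
have s0 : 0 < s by rewrite invr_gt0.
have sq : s * q z = 1 - s.
  rewrite /s -{2}(mulVf (lt0r_neq0 q1)) -[X in _ - X]mulr1 -mulrBr.
  by rewrite [1 + _]addrC addrK.
have := fq (- (s * (f z)^*) *: z).
rewrite fZ qZ normrN normrM (gtr0_norm s0) norm_conjC.
have -> : (- (s * (f z)^*) * f z)^* = - (s * f z) * (f z)^*.
  by rewrite !(rmorphM, rmorphN)/= conjCK (CrealP (gtr0_real s0)).
have -> : - (s * (f z)^*) * f z + - (s * f z) * (f z)^*
    + (s * `|f z|) ^+ 2 * q z = - (s * (1 + s)) * `|f z| ^+ 2.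
  transitivity (- (2 * s) * (f z * (f z)^*) + s * (s * q z) * `|f z| ^+ 2).
    by ring.
  by rewrite sq -normCK; ring.
rewrite mulNr oppr_ge0 pmulr_rle0; last by rewrite mulr_gt0// addr_gt0.
by rewrite real_exprn_even_le0//= normr_eq0 => /eqP.
Qed.

Section Harmonic.
Variable R : realType.

Lemma harmonicC_lt (e : R[i]) :
  0 < e -> \forall k \near \oo, (harmonic k)%:C < e.
Proof.
move=> e0.
have eE : e = (complex.Re e)%:C by rewrite RRe_real// gtr0_real.
have e1 : 0 < complex.Re e by rewrite -ltcR -eE.
have /cvgrPdist_lt/(_ _ e1) := @cvg_harmonic R.
apply: filterS => k /=.
by rewrite sub0r normrN eE ltcR => hk; rewrite (le_lt_trans (ler_norm _) hk).
Qed.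

Lemma cvg_harmonicC (K : numFieldType := R[i]) :
  (fun k => (harmonic k : R)%:C : K) @ \oo --> (0 : K).
Proof.
apply/cvgrPdist_lt => e /harmonicC_lt; apply: filterS => k.
by rewrite sub0r normrN ger0_norm// ler0c harmonic_ge0.
Qed.

End Harmonic.

(** * Bounded operators on a Hilbert space *)

Section Hilbert.
Variables (R : realType) (H : completeNormedModType R[i]).
Variable dot : {dot H for Num.conj}.
Hypothesis hilbertH : hilbert_norm dot.

Lemma dot_conj x y : dot x y = (dot y x)^*.
Proof. by rewrite hermC expr0 mul1r. Qed.

Lemma dot_cauchy_schwarz x y : `|dot x y| <= `|x| * `|y|.
Proof.
have [->|y0] := eqVneq y 0; first by rewrite linear0r !normr0 mulr0.
rewrite -ler_sqr ?nnegrE ?mulr_ge0// exprMn.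
have b0 : 0 < `|y| ^+ 2 by rewrite exprn_gt0// normr_gt0.
(* The square of the norm of this vector is |y|^2 times the difference of the
   two sides. *)
have := dnorm_ge0 dot (`|y| ^+ 2 *: x - dot x y *: y).
rewrite dnormB !dnormZ linearZl_LR linearZr_LR /= -!hilbertH (gtr0_norm b0).
have yr : (`|y|)^* = `|y| by rewrite conj_Creal// ger0_real.
rewrite !rmorphM/= ?conjCK yr -!expr2.
have -> : (`|y| ^+ 2) ^+ 2 * `|x| ^+ 2 + `|dot x y| ^+ 2 * `|y| ^+ 2
   - (`|y| ^+ 2 * ((dot x y)^* * dot x y) + `|y| ^+ 2 * (dot x y * (dot x y)^*))
   = `|y| ^+ 2 * (`|x| ^+ 2 * `|y| ^+ 2 - `|dot x y| ^+ 2).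
  by rewrite normCK; ring.
by rewrite pmulr_rge0// subr_ge0.
Qed.

Lemma dotr_continuous x : continuous (dot x).
Proof.
move=> l; apply/(@cvgrPdist_lt _ _ _ (nbhs l)) => e e0; near=> y.
rewrite -linearBr (le_lt_trans (dot_cauchy_schwarz _ _))//.
have x1 : 0 < 1 + `|x| by rewrite ltr_pwDl.
rewrite (@le_lt_trans _ _ ((1 + `|x|) * `|l - y|))//.
  by rewrite ler_wpM2r// lerDr.
rewrite -ltr_pdivlMl//; near: y; apply: cvgr_dist_lt => //.
by rewrite mulr_gt0// invr_gt0.
Unshelve. all: by end_near. Qed.

Lemma dotl_continuous y : continuous (dot^~ y).
Proof.
move=> l; apply/(@cvgrPdist_lt _ _ _ (nbhs l)) => e e0.
have /(@cvgrPdist_lt _ _ _ (nbhs l))/(_ e e0) := @dotr_continuous y l.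
apply: filterS => x.
by rewrite (dot_conj l) (dot_conj x) -rmorphB norm_conjC.
Qed.

(** The real functional x |-> |x|^2 - 2 Re phi(x) is bounded below, and by the
    parallelogram identity its minimizing sequences are Cauchy; perturbing their
    limit shows that it represents phi. *)
Lemma riesz_representation (phi : H -> R[i]) (r : R[i]) :
  scalar phi -> 0 <= r -> (forall x, `|phi x| <= r * `|x|) ->
  exists y, forall x, phi x = dot x y.
Proof.
move=> phi_lin r0 phi_bnd.
pose L : {scalar H} := HB.pack phi (GRing.isLinear.Build _ _ _ _ phi phi_lin).
have phiD x y : phi (x + y) = phi x + phi y by exact: (linearD L).
have phiZ c x : phi (c *: x) = c * phi x by exact: (linearZ_LR L).
have phiN x : phi (- x) = - phi x by exact: (linearN L).
pose energy x := dot x x - (phi x + (phi x)^*).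
have energyD x z : energy (x + z) =
    energy x + (dot z x - phi z) + (dot z x - phi z)^* + dot z z.
  rewrite /energy dnormD phiD !rmorphD /= -!dot_conj rmorphN/=; ring.
have parallelogram m w :
    energy (m + w) + energy (m - w) = 2 * energy m + 2 * dot w w.
  rewrite !energyD hnormN linearNl phiN/= !rmorphB !rmorphN/=; ring.
have energy_real x : energy x \is Num.real.
  rewrite /energy rpredB//; first by rewrite ger0_real// dnorm_ge0.
  by rewrite CrealE rmorphD /= conjCK addrC.
have energy_lb x : - (r ^+ 2) <= energy x.
  have phi2 : phi x + (phi x)^* <= 2 * (r * `|x|).
    rewrite (le_trans (real_ler_norm _))//.
      by rewrite CrealE rmorphD /= conjCK addrC.
    rewrite (le_trans (ler_normD _ _))// norm_conjC [leRHS]mulr_natl mulr2n.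
    exact: lerD.
  rewrite /energy -hilbertH -subr_ge0.
  rewrite (_ : _ - _ =
    (`|x| - r) ^+ 2 + (2 * (r * `|x|) - (phi x + (phi x)^*))).
    rewrite addr_ge0 ?subr_ge0// -realEsqr rpredB// ger0_real//.
  ring.
(* [energy] is complex-valued with real values, hence the real part before
   taking the infimum. *)
pose E := range (fun x => complex.Re (energy x)).
have E_lb : has_lbound E.
  exists (complex.Re (- r ^+ 2)) => _ [x _ <-].
  by have := energy_lb x; rewrite lecE => /andP[].
have E_inf : has_inf E by split=> //; exists (complex.Re (energy 0)); exists 0.
have inf_le x : (inf E)%:C <= energy x.
  rewrite -(RRe_real (energy_real x)) lecR; apply: ge_inf => //.
  by exists x.
have /choice[u uE] : forall k, exists x,
    energy x <= (inf E)%:C + (harmonic k)%:C.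
  move=> k.
  have [_ [x _ <-] xE] := inf_adherent (harmonic_gt0 k) E_inf.
  exists x; rewrite -(RRe_real (energy_real x)) -rmorphD lecR.
  exact: ltW.
have u_close j k :
    `|u k - u j| ^+ 2 <= 2 * ((harmonic j)%:C + (harmonic k)%:C).
  pose m := 2^-1 *: (u k + u j); pose w := 2^-1 *: (u k - u j).
  have half (v : H) : 2^-1 *: (v + v) = v.
    by rewrite scalerDr -scalerDl (_ : _ + _ = 1) ?scale1r//; field.
  have mw : m + w = u k.
    by rewrite /m /w -scalerDr addrACA subrr addr0 half.
  have mw' : m - w = u j.
    by rewrite /m /w -scalerBr opprB addrC addrA subrK half.
  have w2 : u k - u j = 2 *: w by rewrite scalerA mulfV// scale1r.
  have := parallelogram m w; rewrite mw mw' => pE.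
  have := lerD (uE k) (uE j); rewrite pE => le1.
  have le2 := inf_le m.
  rewrite w2 hilbertH dnormZ normr_nat.
  rewrite -subr_ge0 (_ : _ - _ =
    2 * ((inf E)%:C + (harmonic k)%:C + ((inf E)%:C + (harmonic j)%:C)
      - (2 * energy m + 2 * dot w w))
    + 4 * (energy m - (inf E)%:C)); last by ring.
  by rewrite addr_ge0// mulr_ge0// subr_ge0.
have u_cvg : cvg (u @ \oo).
  apply/cauchy_cvgP/cauchy_exP => e e0.
  have e2 : 0 < e ^+ 2 / 4 by rewrite divr_gt0// exprn_gt0.
  have [N _ hN] := harmonicC_lt e2.
  exists (u N); exists N => // j /= Nj.
  rewrite -ball_normE/= -ltr_sqr ?nnegrE ?(ltW e0)//.
  rewrite (le_lt_trans (u_close j N))//.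
  have h1 := hN _ Nj; have h2 := hN _ (leqnn N).
  rewrite (_ : e ^+ 2 = 2 * (e ^+ 2 / 4 + e ^+ 2 / 4)); last by field.
  by rewrite ltr_pM2l// ltrD.
have /cvg_ex[/= x0 ux0] := u_cvg.
exists x0; move=> z; apply/esym/eqP; rewrite -subr_eq0; apply/eqP; move: z.
apply: (@homogeneous_perturbation_eq0 _ _
  (fun z => dot z x0 - phi z) (fun z => dot z z)).
- by move=> c z; rewrite linearZl_LR phiZ /= mulrBr.
- by move=> c z; rewrite dnormZ.
- by move=> z; exact: dnorm_ge0.
move=> z.
have ->: dot z x0 - phi z + (dot z x0 - phi z)^* + dot z z
  = dot z x0 + dot x0 z + (dot z z - phi z - (phi z)^*) + 0.
  by rewrite rmorphB/= -dot_conj; ring.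
(* This is the limit of energy (u k + z) - energy (u k) >= - harmonic k. *)
apply: (@cvg_ge0 _ (fun k => dot z (u k) + dot (u k) z
  + (dot z z - phi z - (phi z)^*) + (harmonic k)%:C)).
  apply: cvgD; last exact: cvg_harmonicC.
  apply: cvgD; last exact: cvg_cst.
  apply: cvgD.
    exact: continuous_cvg (@dotr_continuous z x0) ux0.
  exact: continuous_cvg (@dotl_continuous z x0) ux0.
apply: nearW => k.
have := lerB (inf_le (u k + z)) (uE k).
rewrite energyD rmorphB/= -dot_conj => le3.
rewrite -subr_ge0 in le3; apply: le_trans le3 _.
by rewrite le_eqVlt; apply/orP; left; apply/eqP; ring.
Qed.

Lemma bounded_operatorP (A : H -> H) : bounded_operator A <->
  linear A /\ exists2 r : R[i], 0 <= r & forall x, `|A x| <= r * `|x|.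
Proof.
split=> [[Alin Acont]|[Alin [r r0 Ar]]]; split=> //;
  pose L : {linear H -> H} := HB.pack A (GRing.isLinear.Build _ _ _ _ A Alin).
- have /linear_bounded_continuous/linear_boundedP : continuous L by [].
  by move=> /pinfty_ex_gt0[r r0 Ar]; exists r => //; exact: ltW.
- apply: (@bounded_linear_continuous _ _ _ L); apply/linear_boundedP.
  near=> s => x; rewrite (le_trans (Ar x))// ler_wpM2r//.
  by near: s; apply: nbhs_pinfty_ge; exact: ger0_real.
Unshelve. all: by end_near. Qed.

Lemma dot_inj x y : (forall z, dot z x = dot z y) -> x = y.
Proof.
move=> xy; apply/eqP; rewrite -subr_eq0 -(dnorm_eq0 dot).
by rewrite linearBr/= (xy (x - y)) subrr.
Qed.

(** Riesz representation of the functionals x |-> <A x, y> gives an operator with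
    the same bound as A, so that [adjoint] does not fall back on its default
    value. *)
Lemma adjointP (A : H -> H) : bounded_operator A ->
  bounded_operator (adjoint dot A) /\
  forall x y, dot (A x) y = dot x (adjoint dot A y).
Proof.
move=> /bounded_operatorP[Alin [r r0 Ar]].
have /choice[B AB] : forall y, exists z, forall x, dot (A x) y = dot x z.
  move=> y; apply: (@riesz_representation _ (r * `|y|)); last 2 first.
  - exact: mulr_ge0.
  - move=> x; rewrite (le_trans (dot_cauchy_schwarz _ _))//.
    by rewrite mulrAC ler_wpM2r.
  - by move=> c x z; rewrite Alin linearDl linearZl_LR.
suff Bbnd : bounded_operator B.
  exact: (@xgetPex _ (fun=> 0) [set B | bounded_operator B /\
    forall x y, dot (A x) y = dot x (B y)]
    (ex_intro _ B (conj Bbnd (fun x y => AB y x)))).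
apply/bounded_operatorP; split.
  move=> c x y; apply: dot_inj => z.
  by rewrite -AB !linearDr !linearZr_LR/= -!AB.
exists r => // y.
have [->|By0] := eqVneq (B y) 0; first by rewrite normr0 mulr_ge0.
(* |B y|^2 = <A (B y), y> is at most r |B y| |y|. *)
rewrite -(@ler_pM2l _ `|B y|) ?normr_gt0// -expr2 hilbertH -AB.
rewrite -[leLHS]ger0_norm; last by rewrite AB dnorm_ge0.
rewrite (le_trans (dot_cauchy_schwarz _ _))// mulrA ler_wpM2r//.
by rewrite [leRHS]mulrC.
Qed.

Lemma op_word_bounded n (X : 'I_n -> H -> H) w :
  (forall i, bounded_operator (X i)) -> bounded_operator (op_word X w).
Proof.
move=> Xb; elim: w => [|i w [wlin wcont]] /=; first by split=> // x.
have [ilin icont] := Xb i.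
split=> [c x y|x]; first by rewrite /= wlin ilin.
apply: continuous_comp; [exact: wcont|exact: icont].
Qed.

(** Polarization: the form is real at x + y and at x + i y, which determines
    the real and the imaginary part of <B x, y>. *)
Lemma positive_hermitian (B : {linear H -> H}) :
  (forall x, 0 <= dot (B x) x) -> forall x y, dot (B x) y = dot x (B y).
Proof.
move=> Bpos x y.
have Breal u : (dot (B u) u)^* = dot (B u) u.
  by rewrite conj_Creal// ger0_real.
have h1 := Breal (x + y); have h2 := Breal (x + 'i *: y).
rewrite (dot_conj x).
move: h1 h2; rewrite !(linearD B) !(linearZ_LR B)/= !linearDl !linearDr.
rewrite !linearZl_LR !linearZr_LR/= !(rmorphD, rmorphM)/=.
rewrite !conjCK !Breal !conjCi.
set p := dot (B x) x; set q := dot (B y) y.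
set s := dot (B x) y; set t := dot (B y) x => h1 h2.
(* Scaling a complex number is multiplying it; the identities below are only
   visible to [ring] in terms of products. *)
have {}h2 : p + 'i * s^* + (- 'i * t^* + 'i * (- 'i * q)) =
  p + - 'i * s + ('i * t + - 'i * ('i * q)) := h2.
have e1 : s^* + t^* = s + t.
  transitivity (p + s^* + (t^* + q) - (p + q)); first by ring.
  by rewrite h1; ring.
have e2 : s^* - t^* = t - s.
  apply: (mulfI (neq0Ci R[i])).
  transitivity (p + 'i * s^* + (- 'i * t^* + 'i * (- 'i * q))
    - p - 'i * (- 'i * q)).
    by ring.
  by rewrite h2; ring.
have : 2 * t^* = 2 * s.
  transitivity (s^* + t^* - (s^* - t^*)); first by ring.
  by rewrite e1 e2; ring.
by move=> /mulfI->//; rewrite pnatr_eq0.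
Qed.

(** The form z |-> <B (m + z), m + z> is minimal at z = 0, so its first-order
    term z |-> <z, B m> vanishes. *)
Lemma positive_form_eq0 (B : {linear H -> H}) m :
  (forall x, 0 <= dot (B x) x) -> dot (B m) m = 0 -> B m = 0.
Proof.
move=> Bpos Bm.
have Bherm := positive_hermitian Bpos.
apply: dot_inj => z; rewrite linear0r; move: z.
apply: (@homogeneous_perturbation_eq0 _ _
  (fun z => dot z (B m)) (fun z => dot (B z) z)) => //.
- by move=> c z; rewrite linearZl_LR.
- by move=> c z; rewrite (linearZ_LR B)/= linearZl_LR linearZr_LR/= mulrA
     normCK.
move=> z; have := Bpos (m + z).
rewrite (linearD B) linearDl !linearDr/= Bm add0r (Bherm z m).
by rewrite -dot_conj addrCA addrA.
Qed.

Lemma orthogonal_closed (A : set H) :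
  let N := [set x | forall m, A m -> dot x m = 0] in
  GRing.submod_closed (mem N) /\ closed N.
Proof.
move=> N; split; first split.
- by rewrite inE => m _; rewrite linear0l.
- move=> c x y; rewrite !inE => Nx Ny m Am.
  by rewrite linearDl linearZl_LR/= Nx// Ny// mulr0 addr0.
have -> : N = \bigcap_(m in A) [set x | dot x m = 0] by [].
apply: closed_bigI => m _.
apply: (@closed_comp _ _ (fun x => dot x m : (R[i] : numFieldType)) [set 0]).
  move=> x _; exact: dotl_continuous.
exact: (accessible_closed_set1 (hausdorff_accessible (@norm_hausdorff _ _))).
Qed.

(** * The quadratic form of Phi *)

Lemma nonneg_word_series_ge_term n (K : numFieldType := R[i])
    (t : seq 'I_n -> R[i]) (s : K) w :
  (forall w, 0 <= t w) -> (0 < size w)%N ->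
  (fun N => \sum_(1 <= k < N) \sum_(w : k.-tuple 'I_n) t w : K) @ \oo --> s ->
  t w <= s.
Proof.
move=> t0 w0 ts; rewrite -subr_ge0.
apply: (@cvg_ge0 _ (fun N =>
  (\sum_(1 <= k < N) \sum_(w : k.-tuple 'I_n) t w : K) - t w)).
  exact: cvgB ts (cvg_cst _).
exists (size w).+1 => // N /= wN; rewrite subr_ge0.
rewrite (big_cat_nat _ (n := size w))//=; last exact: ltnW.
rewrite [X in _ + X]big_ltn// (bigD1 (in_tuple w))//=.
rewrite addrCA -addrA lerDl !addr_ge0 ?sumr_ge0// => i _; exact: sumr_ge0.
Qed.

Section Phi.
Variables (n : nat) (a : seq 'I_n -> R) (T : 'I_n -> H -> H).
Hypothesis a_ge0 : forall w, 0 <= a w.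
Hypothesis T_bounded : forall i, bounded_operator (T i).

Let Tadj w : H -> H := adjoint dot (op_word T w).

Lemma Phi_default_or_sum (Y : H -> H) :
  Phi dot a T Y = (fun=> 0) \/
  bounded_operator (Phi dot a T Y) /\
  is_wot_sum dot (Phi_term dot a T Y) (Phi dot a T Y).
Proof.
have [S_ex|S_nex] := pselect (exists S, bounded_operator S /\
  is_wot_sum dot (Phi_term dot a T Y) S).
  by right; exact: (@xgetPex _ (fun=> 0) [set S | bounded_operator S /\
    is_wot_sum dot (Phi_term dot a T Y) S]).
by left; apply: xgetPN => S bS; apply: S_nex; exists S.
Qed.

Lemma Phi_quadratic_form (Y S : H -> H) (K : numFieldType := R[i]) x :
  is_wot_sum dot (Phi_term dot a T Y) S ->
  (fun N => \sum_(1 <= k < N) \sum_(w : k.-tuple 'I_n)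
     (a w)%:C * dot (Y (Tadj w x)) (Tadj w x) : K) @ \oo --> (dot (S x) x : K).
Proof.
move=> /(_ x x); apply: cvg_trans; apply: near_eq_cvg; apply: nearW => N.
rewrite linear_sumlz; apply: eq_bigr => k _.
rewrite linear_sumlz; apply: eq_bigr => w _.
rewrite linearZl_LR/=; congr (_ * _).
by have [_ ->] := adjointP (op_word_bounded w T_bounded).
Qed.

(** The difference of the two quadratic forms is the sum over the words of
    nonnegative terms, so it dominates each of them.  This yields both the
    monotonicity of Phi and, when the difference is 0, equality in each term. *)
Lemma Phi_gap_ge_term (Y Z SY SZ : H -> H) w x :
  op_le dot Y Z -> (0 < size w)%N ->
  is_wot_sum dot (Phi_term dot a T Y) SY ->
  is_wot_sum dot (Phi_term dot a T Z) SZ ->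
  (a w)%:C * (dot (Z (Tadj w x)) (Tadj w x) - dot (Y (Tadj w x)) (Tadj w x)) <=
  dot (SZ x) x - dot (SY x) x.
Proof.
move=> YZ w0 YS ZS.
apply: (@nonneg_word_series_ge_term _ (fun w => (a w)%:C *
  (dot (Z (Tadj w x)) (Tadj w x) - dot (Y (Tadj w x)) (Tadj w x)))) => //.
  by move=> v; rewrite mulr_ge0 ?ler0c// subr_ge0; exact: YZ.
apply: cvg_trans
  (cvgB (@Phi_quadratic_form _ _ x ZS) (@Phi_quadratic_form _ _ x YS)).
apply: near_eq_cvg; apply: nearW => N.
rewrite -[LHS]sumrB; apply: eq_bigr => k _.
by rewrite -sumrB; apply: eq_bigr => v _; rewrite mulrBr.
Qed.
End Phi.
End Hilbert.

Unset Implicit Arguments.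

(** * The invariant subspace *)

Theorem corollary4p10 (R : realType) (H : completeNormedModType R[i])
    (dot : {dot H for Num.conj}) (hilbertH : hilbert_norm dot)
    (n : nat) (n_gt0 : (0 < n)%N)
    (a : seq 'I_n -> R) (a_regular : positive_regular_free_holomorphic a)
    (P : set (nc_polynomial R n))
    (T : 'I_n -> H -> H) (T_variety : noncommutative_variety dot a P T)
    (Phi_neqI : Phi dot a T idfun <> idfun)
    (fixed_vector : exists2 h : H, h != 0 &
       forall k : nat, (0 < k)%N ->
         dot (iter k (Phi dot a T) idfun h) h = `|h| ^+ 2) :
  exists M : set H, nontrivial_invariant_subspace T M.
Proof.
have [_ a_ge0 _ a_letter] := a_regular.
have [T_bounded _ Phi_le _] := T_variety.
have [h h0 hfix] := fixed_vector.
pose S k := iter k (Phi dot a T) idfun.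
(* The default value of Phi is excluded by the vector h. *)
have Swot k : bounded_operator (S k.+1) /\
    is_wot_sum dot (Phi_term dot a T (S k)) (S k.+1).
  have [S0|//] := Phi_default_or_sum dot a T (S k).
  have := hfix k.+1 isT; rewrite iterS S0 linear0l => /esym/eqP.
  by rewrite expf_eq0/= normr_eq0 (negPf h0).
have S_le k : op_le dot (S k) idfun.
  elim: k => [|k IH] x //.
  apply: le_trans (Phi_le x).
  have := Phi_gap_ge_term hilbertH a_ge0 T_bounded
    (w := [:: Ordinal n_gt0]) x IH isT (Swot k).2 (Swot 0%N).2.
  move=> gap; rewrite -subr_ge0; apply: le_trans gap.
  by rewrite mulr_ge0 ?ler0c// subr_ge0; exact: IH.
pose M := [set m | forall k, dot (S k m) m = dot m m].
have M_adj m i : M m -> M (adjoint dot (T i) m).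
  move=> Mm k.
  have := Phi_gap_ge_term hilbertH a_ge0 T_bounded
    (w := [:: i]) m (S_le k) isT (Swot k).2 (Swot 0%N).2.
  have ai_gt0 : 0 < (a [:: i])%:C :> R[i] by rewrite ltcR.
  rewrite !Mm subrr pmulr_rle0// subr_le0 => le1.
  by apply/eqP; rewrite eq_le le1 andbT; exact: S_le.
pose B x := x - S 1%N x.
have Blin : linear B.
  move=> c x y; rewrite /B ((Swot 0%N).1.1 c x y) scalerBr opprD !addrA.
  by congr (_ + _); rewrite addrAC.
have Bpos x : 0 <= dot (B x) x by rewrite linearBl subr_ge0; exact: S_le.
pose Bl : {linear H -> H} := HB.pack B (GRing.isLinear.Build _ _ _ _ B Blin).
have Bm m : M m -> B m = 0.
  move=> Mm; apply: (@positive_form_eq0 _ _ dot Bl) => //.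
  apply/eqP; rewrite linearBl subr_eq0; apply/eqP/esym; exact: (Mm 1%N).
have Bherm : forall x y, dot (B x) y = dot x (B y).
  exact: (@positive_hermitian _ _ dot Bl).
exists [set x | forall m, M m -> dot x m = 0].
have [N_submod N_closed] := orthogonal_closed hilbertH M.
split=> //.
- move=> N0; apply: Phi_neqI; apply/funext => x.
  apply/eqP; rewrite eq_sym -subr_eq0; apply/eqP.
  have : [set 0] (B x).
    by rewrite -N0 => m /Bm; rewrite Bherm => ->; exact: linear0r.
  by [].
- move=> NT.
  have Mh : M h by case=> [//|k]; rewrite -hilbertH; exact: hfix.
  have : setT h by [].
  by rewrite -NT => /(_ h Mh)/eqP; rewrite dnorm_eq0 (negPf h0).
- move=> i x Nx m Mm.
  have [_ ->] := adjointP hilbertH (T_bounded i).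
  by apply: Nx; exact: M_adj.
Qed.
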